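(* Every 2-tree admits a planar (crossing-free) strongly monotone drawing.
   Context: Graphs are finite and simple. A 2-tree is a graph that can be produced from the complete graph $K_3$ by repeatedly (zero or more times) adding a new vertex whose neighbors, at the time it is added, are exactly the two end-points of an existing edge. A straight-line drawing of a graph $G=(V,E)$ maps the vertices to distinct points of the plane $\mathbb{R}^2$ and each edge to the straight-line segment between its end-points; vertices are identified with the points they are mapped to. It is planar (crossing-free) if edges intersect only at common end-points and no edge passes through a vertex other than its end-points. For nonzero vectors $x,y\in\mathbb{R}^2$, let $\measuredangle(x,y)=\arccos\left(\frac{\langle x,y\rangle}{|x||y|}\right)$. A path $v_1v_2\dots v_k$ in a straight-line drawing is strongly monotone if $\measuredangle(\overrightarrow{v_iv_{i+1}},\overrightarrow{v_1v_k})<\pi/2$ for all $1\le i\le k-1$ (strict monotonicity: no edge of the path is orthogonal to $\overrightarrow{v_1v_k}$). A straight-line drawing of $G$ is strongly monotone if every pair of distinct vertices $u,v\in V$ is connected by a path of $G$ from $u$ to $v$ that is strongly monotone. *)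

(* Defs.v *)
From mathcomp Require Import all_boot all_order all_algebra.
From mathcomp Require Import boolp classical_sets set_interval reals trigo.

Set Implicit Arguments.
Unset Strict Implicit.
Unset Printing Implicit Defensive.
Import Order.TTheory GRing.Theory Num.Theory.
Local Open Scope ring_scope.

(* [two_tree_on E S]: the subgraph of [(V, E)] induced by [S] is produced from
   K_3 by successively adding vertices.  A step never changes adjacency between
   the vertices already present, so every intermediate graph of a construction
   of [(V, E)] is the subgraph induced by the vertices added so far. *)
Inductive two_tree_on (V : finType) (E : rel V) : {set V} -> Prop :=
| two_tree_K3 (S : {set V}) :
    #|S| = 3%N -> {in S &, forall x y, E x y = (x != y)} -> two_tree_on E S
| two_tree_add (S : {set V}) (a b v : V) :
    two_tree_on E S -> a \in S -> b \in S -> E a b ->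
    v \notin S -> {in S, forall x, E v x = (x \in [set a; b])} ->
    two_tree_on E (v |: S).

Definition simple_graph (V : finType) (E : rel V) : Prop :=
  symmetric E /\ irreflexive E.

Definition two_tree (V : finType) (E : rel V) : Prop :=
  simple_graph E /\ two_tree_on E [set: V].

Section Plane.
Variable R : realType.
Implicit Types x y : 'rV[R]_2.

Definition dot x y : R := \sum_i x 0 i * y 0 i.

(* The library norm [`|x|] on row vectors is the sup norm. *)
Definition enorm x : R := Num.sqrt (dot x x).

Definition angle x y : R := acos (dot x y / (enorm x * enorm y)).

Definition segment x y : set 'rV[R]_2 :=
  [set (1 - t) *: x + t *: y | t in `[0, 1]%classic]%classic.

End Plane.

Section Drawing.
Variables (R : realType) (V : finType) (E : rel V).
(* [p] maps vertices to points; the drawing of an edge is then determined. *)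
Variable p : V -> 'rV[R]_2.

Definition straight_line_drawing : Prop := injective p.

Definition planar_drawing : Prop :=
  (forall a b c d z, E a b -> E c d -> [set a; b]%SET != [set c; d]%SET ->
     segment (p a) (p b) z -> segment (p c) (p d) z ->
     exists w, [/\ w \in [set a; b]%SET, w \in [set c; d]%SET & z = p w]) /\
  (forall a b w, E a b -> w \notin [set a; b]%SET ->
     ~ segment (p a) (p b) (p w)).

Definition graph_path (u : V) (s : seq V) : bool := path E u s && uniq (u :: s).

(* The path is [u :: s]; seq's [path] ranges over its consecutive vertices. *)
Definition strongly_monotone_path (u : V) (s : seq V) : bool :=
  path (fun a b => angle (p b - p a) (p (last u s) - p u) < pi / 2) u s.

Definition strongly_monotone_drawing : Prop :=
  forall u v, u != v ->
    exists s, [/\ graph_path u s, last u s = v & strongly_monotone_path u s].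

End Drawing.

(* Main.v *)
(* Every drawn edge [ab] carries a bubble: a point [m] at which the angle [amb]
   is obtuse.  The invariant is that the drawing, enlarged by all bubbles as
   virtual vertices of degree two, is crossing-free and strongly monotone.  To
   stack [v] on [ab], put [v] next to [m] inside the triangle [amb], almost on
   the circle about [a] through [m]: then the angles of the triangle [avm] at
   [v] and [m] are acute, so the path [v a m] is strongly monotone.  Give [av] a
   bubble slightly beyond [v] on the ray from [b] through [v], and [bv] a bubble
   slightly beyond [v] on the ray from [a] through [v]; the angle condition at
   [v] makes the new angles obtuse, and a path that used to leave [v] through
   [b] can be continued backwards to the bubble of [av].  Everything else
   persists because the conditions are open. *)

Require Import Defs.
From mathcomp Require Import all_boot all_order all_algebra.
From mathcomp Require Import classical_sets filter reals.
From mathcomp Require Import topology normedtype trigo ring lra.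

Set Implicit Arguments.
Unset Strict Implicit.
Unset Printing Implicit Defensive.
Import Order.TTheory GRing.Theory Num.Theory.
Import numFieldNormedType.Exports.
Local Open Scope ring_scope.

(** * Stable predicates of plane geometry *)

Section Geometry.
Local Open Scope classical_set_scope.
Variable R : realType.
Notation pt := (R * R)%type.
Implicit Types a b c d q w x y z : pt.

(** [dp] and [cp] are the inner product and the determinant of the vectors [b - a] and [d - c]. *)
Definition dp a b c d : R :=
  (b.1 - a.1) * (d.1 - c.1) + (b.2 - a.2) * (d.2 - c.2).

Definition cp a b c d : R :=
  (b.1 - a.1) * (d.2 - c.2) - (b.2 - a.2) * (d.1 - c.1).

Definition lin (f a : pt) : R := f.1 * a.1 + f.2 * a.2.

(* Disjointness of the segments [ab] and [cd], in a form that is visibly stable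
   under small perturbations. *)
Definition sep a b c d : Prop :=
  exists f k, [/\ lin f a < k, lin f b < k, k < lin f c & k < lin f d].

(* For nonzero vectors: the segments [xy] and [xz] meet only in [x]. *)
Definition spread x y z : bool := (cp x y x z != 0) || (dp x y x z < 0).

(** The determinant excludes the straight angle, so [q] stays off the line [ab]. *)
Definition obtuse q a b : bool := (dp q a q b < 0) && (cp q a q b != 0).

(** For [t > 0] this is a point beyond [v] on the ray from [a] through [v]. *)
Definition ray v a (t : R) : pt := (v.1 + t * (v.1 - a.1), v.2 + t * (v.2 - a.2)).

Lemma sep_swap a b c d : sep a b c d -> sep c d a b.
Proof.
move=> [[f1 f2] [k []]]; rewrite /lin /= => h1 h2 h3 h4.
by exists (- f1, - f2), (- k); rewrite /lin /=; split; lra.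
Qed.

Lemma sepCl a b c d : sep a b c d -> sep b a c d.
Proof. by move=> [f [k []]]; exists f, k. Qed.

Lemma sepCr a b c d : sep a b c d -> sep a b d c.
Proof. by move=> [f [k []]]; exists f, k. Qed.

Lemma sep_diag a b c d : sep a b c d -> sep a a c d.
Proof. by move=> [f [k []]]; exists f, k. Qed.

Lemma spreadC x y z : spread x y z = spread x z y.
Proof.
rewrite /spread; have -> : cp x y x z = - cp x z x y by rewrite /cp; ring.
by rewrite oppr_eq0; have -> : dp x y x z = dp x z x y by rewrite /dp; ring.
Qed.

Lemma obtuseC q a b : obtuse q a b = obtuse q b a.
Proof.
rewrite /obtuse; have -> : cp q a q b = - cp q b q a by rewrite /cp; ring.
by rewrite oppr_eq0; have -> : dp q a q b = dp q b q a by rewrite /dp; ring.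
Qed.

(** * Persistence of strict inequalities under small perturbations *)

Section Cvg.
Variables (T : Type) (F : set_system T) (FF : Filter F).

Lemma cvg_fst1 (A : T -> pt) a : A @ F --> a -> (A t).1 @[t --> F] --> a.1.
Proof. by move=> cA; apply: cvg_comp cA _; exact: cvg_fst. Qed.

Lemma cvg_snd2 (A : T -> pt) a : A @ F --> a -> (A t).2 @[t --> F] --> a.2.
Proof. by move=> cA; apply: cvg_comp cA _; exact: cvg_snd. Qed.

Variables (A B C D : T -> pt) (a b c d : pt).
Hypotheses (cA : A @ F --> a) (cB : B @ F --> b).
Hypotheses (cC : C @ F --> c) (cD : D @ F --> d).

Lemma cvg_dp : dp (A t) (B t) (C t) (D t) @[t --> F] --> dp a b c d.
Proof.
by apply: cvgD; apply: cvgM; apply: cvgB;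
  (exact: cvg_fst1 || exact: cvg_snd2).
Qed.

Lemma cvg_cp : cp (A t) (B t) (C t) (D t) @[t --> F] --> cp a b c d.
Proof.
by apply: cvgB; apply: cvgM; apply: cvgB;
  (exact: cvg_fst1 || exact: cvg_snd2).
Qed.

Lemma near_dp_gt0 : 0 < dp a b c d ->
  \forall t \near F, 0 < dp (A t) (B t) (C t) (D t).
Proof. by move=> h; apply: cvgr_gt h; exact: cvg_dp. Qed.

Lemma near_dp_lt0 : dp a b c d < 0 ->
  \forall t \near F, dp (A t) (B t) (C t) (D t) < 0.
Proof. by move=> h; apply: cvgr_lt h; exact: cvg_dp. Qed.

Lemma near_cp_neq0 : cp a b c d != 0 ->
  \forall t \near F, cp (A t) (B t) (C t) (D t) != 0.
Proof.
by move=> h; apply: cvgr_neq0 h; exact: cvg_cp.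
Qed.

End Cvg.

Lemma near_sep q a b c : sep q a b c -> \forall w \near q, sep w a b c.
Proof.
move=> [f [k [h1 h2 h3 h4]]].
have cf : lin f w @[w --> q] --> lin f q.
  apply: cvgD; apply: cvgM; try exact: cvg_cst.
    by apply: cvg_fst1; exact: cvg_id.
  by apply: cvg_snd2; exact: cvg_id.
near=> w; exists f, k; split=> //; near: w.
by apply: cvgr_lt h1; exact: cf.
Unshelve. all: by end_near. Qed.

Ltac cvg_pt := first [exact: cvg_id | exact: cvg_cst].

Lemma near_spread x q y :
  spread x q y -> \forall w \near q, spread x w y.
Proof.
case/orP => h; near=> w; apply/orP; [left|right]; near: w.
  by apply: near_cp_neq0 h; cvg_pt.
by apply: near_dp_lt0 h; cvg_pt.
Unshelve. all: by end_near. Qed.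

Lemma near_obtuse q x y :
  obtuse q x y -> \forall w \near q, obtuse w x y.
Proof.
case/andP => h1 h2; near=> w; apply/andP; split; near: w.
  by apply: near_dp_lt0 h1; cvg_pt.
by apply: near_cp_neq0 h2; cvg_pt.
Unshelve. all: by end_near. Qed.

(* [w] enters the triangle [a q b] tangentially to the circle about [a]
   through [q] and then bends inwards, so that the angles of the triangle
   [a q w] at [q] and at [w] are both acute. *)
Lemma obtuse_shift a b q (U : set pt) : obtuse q a b -> nbhs q U ->
  exists w, [/\ U w, sep w a q b, sep w b q a,
    (cp a w a q != 0) && (cp b w b q != 0) & (0 < dp w a w q) && (0 < dp q a q w)].
Proof.
case: a b q => [a1 a2] [b1 b2] [q1 q2] /andP[]; rewrite /dp /cp /=.
set A1 := a1 - q1; set A2 := a2 - q2; set B1 := b1 - q1; set B2 := b2 - q2.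
set K := A1 * B2 - A2 * B1 => obt K0 nU.
(* Write [A = a - q] and [B = b - q]. The parts of [al] and [be] linear in [t] give a vector
   orthogonal to [A]; the quadratic term makes [<A, w - q>] equal to [t^2 K^2 r / 2], which is
   positive but at most half of [|w - q|^2]. *)
set r := A1 ^+ 2 + A2 ^+ 2; set k := - (A1 * B1 + A2 * B2).
pose al (t : R) := t * (k + t * (K ^+ 2 / 2)); pose be (t : R) := t * r.
pose w (t : R) : pt := (q1 + (al t * A1 + be t * B1), q2 + (al t * A2 + be t * B2)).
have cid : t @[t --> (0:R)^'+] --> (0:R) by apply: cvg_at_right_filter; exact: cvg_id.
have cal : al t @[t --> (0:R)^'+] --> (0:R).
  rewrite -[X in _ --> X](mul0r (k + 0 * (K ^+ 2 / 2))).
  by apply: cvgM => //; apply: cvgD; [exact: cvg_cst | apply: cvgM => //; exact: cvg_cst].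
have cbe : be t @[t --> (0:R)^'+] --> (0:R).
  by rewrite -[X in _ --> X](mul0r r); apply: cvgM => //; exact: cvg_cst.
have cw : w t @[t --> (0:R)^'+] --> ((q1, q2) : pt).
  have c (q A B : R) : q + (al t * A + be t * B) @[t --> (0:R)^'+] --> q.
    rewrite -[X in _ --> X](_ : q + (0 * A + 0 * B) = _); last by ring.
    by apply: cvgD; [exact: cvg_cst | apply: cvgD; apply: cvgM => //; exact: cvg_cst].
  exact: (cvg_pair (c q1 A1 B1) (c q2 A2 B2)).
have k0 : 0 < k by rewrite /k; lra.
have K2 : 0 < K ^+ 2 by rewrite exprn_even_gt0.
have r0 : 0 < r.
  rewrite lt_neqAle addr_ge0 ?sqr_ge0 // andbT eq_sym paddr_eq0 ?sqr_ge0 //.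
  rewrite !sqrf_eq0; apply: contra K0 => /andP[/eqP e1 /eqP e2].
  by rewrite /K e1 e2 !mul0r subrr.
have [t [t0 [Uw [al1 be1]]]] : exists t, 0 < t /\ (U (w t) /\ (al t < 1 /\ be t < 1)).
  apply: (@filter_ex _ ((0:R)^'+)); apply: filterI; first exact: nbhs_right_gt.
  apply: filterI; first exact: (cw _ nU).
  by apply: filterI; [exact: (cvgr_lt _ cal)|exact: (cvgr_lt _ cbe)].
have al0 : 0 < al t by apply: mulr_gt0 => //; apply: addr_gt0 => //; rewrite mulr_gt0 // divr_gt0.
have be0 : 0 < be t by apply: mulr_gt0.
have eA1 : a1 = q1 + A1 by rewrite /A1; ring.
have eA2 : a2 = q2 + A2 by rewrite /A2; ring.
have eB1 : b1 = q1 + B1 by rewrite /B1; ring.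
have eB2 : b2 = q2 + B2 by rewrite /B2; ring.
have Ek : al t * r - be t * k = t ^+ 2 * (K ^+ 2 * r / 2) by rewrite /al /be; ring.
have Eb : be t = t * r by [].
have half (g : R) : 0 < g -> g < 1 -> [/\ 0 < g / 2 * K ^+ 2,
    0 < g * K ^+ 2 - g / 2 * K ^+ 2 & 0 < K ^+ 2 - g / 2 * K ^+ 2].
  move=> g0 g1; split; [rewrite pmulr_lgt0|rewrite subr_gt0 ltr_pM2r
    |rewrite subr_gt0 gtr_pMl] => //; lra.
exists (w t); move: Uw; rewrite /w eA1 eA2 eB1 eB2 /cp /dp /=.
move: (al t) (be t) al0 be0 al1 be1 Ek Eb =>
  {eA1 eA2 eB1 eB2 cw w cal cbe al be cid} al be al0 be0 al1 be1 Ek Eb Uw.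
have gt0_eq (x y : R) : 0 < x -> y = x -> 0 < y by move=> + ->.
have [a_0 a_1 a_2] := half _ al0 al1; have [b_0 b_1 b_2] := half _ be0 be1.
split.
- exact: Uw.
(* The separating line is parallel to [qb], halfway between [qb] and [w]; [a] lies beyond it because
   [al < 1]. The factor [K] orients the normal towards [a]. *)
- apply: sep_swap; exists (K * B2, - K * B1), (K * (q1 * B2 - q2 * B1) + al / 2 * K ^+ 2).
  rewrite /lin /=; split; rewrite -subr_gt0.
  + by apply: gt0_eq a_0 _; ring.
  + by apply: gt0_eq a_0 _; ring.
  + by apply: gt0_eq a_1 _; rewrite /K; ring.
  + by apply: gt0_eq a_2 _; rewrite /K; ring.
- apply: sep_swap; exists (- K * A2, K * A1), (K * (q2 * A1 - q1 * A2) + be / 2 * K ^+ 2).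
  rewrite /lin /=; split; rewrite -subr_gt0.
  + by apply: gt0_eq b_0 _; ring.
  + by apply: gt0_eq b_0 _; ring.
  + by apply: gt0_eq b_1 _; rewrite /K; ring.
  + by apply: gt0_eq b_2 _; rewrite /K; ring.
- have neq0_eq (x y : R) : x != 0 -> y = x -> y != 0 by move=> + ->.
  apply/andP; split.
    apply: (neq0_eq (be * K)); first by rewrite mulf_neq0 // gt_eqF.
    by rewrite /K; ring.
  apply: (neq0_eq (- (al * K))); first by rewrite oppr_eq0 mulf_neq0 // gt_eqF.
  by rewrite /K; ring.
- have Aw : 0 < al * r - be * k.
    rewrite Ek; apply: mulr_gt0; first exact: exprn_gt0.
    by apply: divr_gt0 => //; exact: mulr_gt0.
  apply/andP; split; last first.
    by apply: gt0_eq Aw _; rewrite /r /k; ring.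
  (* After multiplication by [r = |A|^2], Lagrange's identity applies: [|A|^2 |w - q|^2] is the sum
     of the squares of [<A, w - q>] and of the determinant [be * K]. *)
  rewrite -(pmulr_rgt0 _ r0).
  apply: (gt0_eq ((t ^+ 2 * (K ^+ 2 * r / 2)) ^+ 2 + t ^+ 2 * r ^+ 2 * K ^+ 2 / 2)).
    rewrite ltr_wpDl ?sqr_ge0 //; apply: divr_gt0 => //.
    by apply: mulr_gt0 => //; apply: mulr_gt0; exact: exprn_gt0.
  transitivity ((al * r - be * k) ^+ 2 + be ^+ 2 * K ^+ 2 - r * (al * r - be * k)).
    by rewrite /r /k /K; ring.
  by rewrite Ek Eb; field.
Qed.

(** * Points beyond an obtuse apex *)

Lemma near_ray v b (U : set pt) : nbhs v U -> exists2 t : R, 0 < t & U (ray v b t).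
Proof.
move=> nU; have c (x y : R) : x + t * (x - y) @[t --> (0:R)^'+] --> x.
  rewrite -[X in _ --> X](_ : x + 0 * (x - y) = _); last by ring.
  apply: cvgD; first exact: cvg_cst.
  by apply: cvgM; [apply: cvg_at_right_filter; exact: cvg_id | exact: cvg_cst].
case: v => v1 v2 in nU *; have [t [t0 Ut]] :
    exists t : R, 0 < t /\ U (ray (v1, v2) b t).
  apply: (@filter_ex _ ((0:R)^'+)); apply: filterI; first exact: nbhs_right_gt.
  exact: (cvg_pair (c v1 b.1) (c v2 b.2) nU).
by exists t.
Qed.

Lemma dp_ray v b t x y : dp (ray v b t) v x y = t * dp v b x y.
Proof. by rewrite /dp /=; ring. Qed.

(** Seen from [ray v b t], the vertex [v] lies in the direction of [b - v]. With that vector the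
    angle condition already holds at [t = 0], by obtuseness at [v], hence also for small [t]. *)
Lemma obtuse_ray v a b t : 0 < t -> obtuse v a b -> dp (ray v b t) a v b < 0 ->
  obtuse (ray v b t) a v.
Proof.
move=> t0 /andP[_ K0] h; apply/andP; split.
  have -> : dp (ray v b t) a (ray v b t) v = t * dp (ray v b t) a v b.
    by rewrite /dp /=; ring.
  by rewrite pmulr_rlt0.
have -> : cp (ray v b t) a (ray v b t) v = t * cp v a v b by rewrite /cp /=; ring.
by rewrite mulf_neq0 // gt_eqF.
Qed.

Lemma cp_ray v a b t : 0 < t -> obtuse v a b -> cp a (ray v b t) a v != 0.
Proof.
move=> t0 /andP[_ K0].
have -> : cp a (ray v b t) a v = - (t * cp v a v b) by rewrite /cp /=; ring.
by rewrite oppr_eq0 mulf_neq0 // gt_eqF.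
Qed.

Lemma obtuse_gt0 v a b : obtuse v a b -> 0 < dp v b v b.
Proof.
case/andP=> _ K0.
rewrite lt_neqAle addr_ge0 -?expr2 ?sqr_ge0 // andbT eq_sym.
rewrite paddr_eq0 ?sqr_ge0 // !sqrf_eq0; apply: contra K0 => /andP[/eqP e1 /eqP e2].
by rewrite /cp e1 e2 !mulr0 subrr.
Qed.

(** The cases for [z] are the objects that can be adjacent to [v] when the bubble is attached: its
    two neighbours and a bubble of the other edge. *)
Lemma spread_ray v a b z t : 0 < t -> obtuse v a b ->
  z = a \/ z = b \/ (exists2 c, 0 < c & z = ray v a c) -> spread v (ray v b t) z.
Proof.
move=> t0 obt; have /andP[_ K0] := obt; move=> [->|[->|[c c0 ->]]]; apply/orP.
- left; have -> : cp v (ray v b t) v a = t * cp v a v b by rewrite /cp /=; ring.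
  by rewrite mulf_neq0 // gt_eqF.
- right; have -> : dp v (ray v b t) v b = - (t * dp v b v b) by rewrite /dp /=; ring.
  by rewrite oppr_lt0 pmulr_rgt0 // (obtuse_gt0 obt).
- left; have -> : cp v (ray v b t) v (ray v a c) = - (t * c * cp v a v b).
    by rewrite /cp /=; ring.
  by rewrite oppr_eq0 !mulf_neq0 // gt_eqF.
Qed.

(** A line perpendicular to [ab], slightly past [v] towards [a], separates. As the angle at [v] is
    obtuse, those at [a] and [b] are acute, so moving from [b] through [v] advances towards [a], and
    moving from [a] through [v] advances towards [b]. *)
Lemma sep_ray v a b z t : 0 < t -> obtuse v a b ->
  z = b \/ (exists2 c, 0 < c & z = ray v a c) -> sep (ray v b t) a v z.
Proof.
move=> t0 /andP[obt K0] hz.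
have A0 : 0 <= dp v a v a by rewrite addr_ge0 // -expr2 sqr_ge0.
have B0 : 0 <= dp v b v b by rewrite addr_ge0 // -expr2 sqr_ge0.
have hA : 0 < dp b a v a by move: obt A0; rewrite /dp; lra.
have hB : 0 < dp b a b v by move: obt B0; rewrite /dp; lra.
have hz0 : dp b a v z < 0.
  case: hz => [->|[c c0 ->]]; first by move: hB; rewrite /dp; lra.
  have -> : dp b a v (ray v a c) = - (c * dp b a v a) by rewrite /dp /=; ring.
  by rewrite oppr_lt0 pmulr_rgt0.
have hw : 0 < dp b a v (ray v b t).
  have -> : dp b a v (ray v b t) = t * dp b a b v by rewrite /dp /=; ring.
  by rewrite pmulr_rgt0.
pose m := Num.min (dp b a v a) (dp b a v (ray v b t)).
have m0 : 0 < m by rewrite lt_min hA hw.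
have [m1 m2] : m <= dp b a v a /\ m <= dp b a v (ray v b t).
  by rewrite !ge_min !lexx orbT.
apply: sep_swap; exists (a.1 - b.1, a.2 - b.2), (lin (a.1 - b.1, a.2 - b.2) v + m / 2).
by move: hz0 m0 m1 m2; rewrite /lin /dp; move: (ray v b t) m => w m /=; split; lra.
Qed.

(** The line is parallel to [ab], halfway between it and the single point [v]. *)
Lemma sep_apex v a b : obtuse v a b -> sep v v a b.
Proof.
move=> /andP[_ K0]; have K2 : 0 < cp v a v b ^+ 2 by rewrite exprn_even_gt0.
pose K := cp v a v b; pose f : pt := (K * (b.2 - a.2), K * (a.1 - b.1)).
have fa : lin f a = lin f v + K ^+ 2 by rewrite /lin /f /K /cp /=; ring.
have fb : lin f b = lin f v + K ^+ 2 by rewrite /lin /f /K /cp /=; ring.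
exists f, (lin f v + K ^+ 2 / 2); rewrite fa fb.
by move: K2; rewrite -/K; split; lra.
Qed.

Lemma near_all (I : finType) (p : pred I) (Q : I -> pt -> Prop) q :
  (forall i, p i -> \forall w \near q, Q i w) ->
  \forall w \near q, forall i, p i -> Q i w.
Proof.
move=> h; apply: (@filter_forall pt _ (fun i w => p i -> Q i w) (nbhs q) _) => i.
case: (boolP (p i)) => [pi|_]; last by near=> w.
by near=> w => _; near: w; exact: h.
Unshelve. all: by end_near. Qed.

End Geometry.

(** * Adding one vertex to a crossing-free drawing *)

Section CrossingFree.
Variables (R : realType) (W : finType) (adj : rel W).
Notation pt := (R * R)%type.
Implicit Types (D : {set W}) (P : W -> pt).

Definition upd P n w : W -> pt := fun o => if o == n then w else P o.

Lemma updn P n w : upd P n w n = w.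
Proof. by rewrite /upd eqxx. Qed.

Lemma updD D P n w o : n \notin D -> o \in D -> upd P n w o = P o.
Proof. by move=> nD oD; rewrite /upd; case: eqP => // e; move: nD; rewrite -e oD. Qed.

Definition crossing_free D P : Prop :=
  (forall x y z u, x \in D -> y \in D -> z \in D -> u \in D ->
     adj x y -> adj z u -> [&& x != z, x != u, y != z & y != u] ->
     sep (P x) (P y) (P z) (P u)) /\
  (forall x y z, x \in D -> y \in D -> z \in D -> adj x y -> adj x z -> y != z ->
     spread (P x) (P y) (P z)).

Hypotheses (adjC : symmetric adj) (adj0 : irreflexive adj).

(** Only pairs containing an edge [nt] with [t] in [D] are new. Such an edge meets an old edge in no
    vertex or in [t], and another new edge in [n]. *)
Lemma add_crossing_free D P n w : n \notin D -> crossing_free D P ->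
  (forall t, t \in D -> adj n t ->
     (forall y z, y \in D -> z \in D -> adj y z -> y != t -> z != t ->
        sep w (P t) (P y) (P z)) /\
     (forall z, z \in D -> adj t z -> spread (P t) w (P z))) ->
  (forall t t', t \in D -> t' \in D -> adj n t -> adj n t' -> t != t' ->
     spread w (P t) (P t')) ->
  crossing_free (n |: D) (upd P n w).
Proof.
move=> nD [cf1 cf2] hN hS.
have oldP o (oD : o \in D) := updD P w nD oD.
have sepn t y z : t \in D -> y \in n |: D -> z \in n |: D -> adj n t -> adj y z ->
    [&& n != y, n != z, t != y & t != z] -> sep w (P t) (upd P n w y) (upd P n w z).
  move=> tD; rewrite !inE ![_ == n]eq_sym.
  move=> /orP yD /orP zD at_ ayz /and4P[/negPf ny /negPf nz ty tz].
  rewrite ny nz in yD zD; case: yD zD => // yD [] // zD.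
  by rewrite !oldP //; apply: (hN t tD at_).1; rewrite 1?eq_sym.
split.
- move=> x y z u xD yD zD uD axy azu dj.
  have [xn|xn] := eqVneq x n.
    subst x; move: yD; rewrite !inE => /orP[/eqP yn|yD]; first by rewrite yn adj0 in axy.
    by rewrite updn (oldP y) //; exact: sepn.
  have [yn|yn] := eqVneq y n.
    subst y; move: xD; rewrite !inE (negPf xn) /= => xD.
    rewrite updn (oldP x) //; apply: sepCl; apply: sepn => //; first by rewrite adjC.
    by case/and4P: dj => -> -> -> ->.
  have {xn}xD : x \in D by move: xD; rewrite !inE (negPf xn).
  have {yn}yD : y \in D by move: yD; rewrite !inE (negPf yn).
  case/and4P: dj => xz xu yz yu.
  have [zn|zn] := eqVneq z n.
    subst z; move: uD; rewrite !inE => /orP[/eqP un|uD]; first by rewrite un adj0 in azu.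
    rewrite updn (oldP u) //; apply: sep_swap; apply: sepn; rewrite ?inE ?xD ?yD ?orbT //.
    by rewrite ![n == _]eq_sym ![u == _]eq_sym xz yz xu yu.
  have [un|un] := eqVneq u n.
    subst u; move: zD; rewrite !inE (negPf zn) /= => zD.
    rewrite updn (oldP z) //; apply: sep_swap; apply: sepCl.
    apply: sepn; rewrite ?inE ?xD ?yD ?orbT //; first by rewrite adjC.
    by rewrite ![n == _]eq_sym ![z == _]eq_sym xz yz xu yu.
  move: zD uD; rewrite !inE (negPf zn) (negPf un) /= => zD uD.
  by rewrite !oldP //; apply: cf1 => //; rewrite xz xu yz yu.
- move=> x y z xD yD zD axy axz yz.
  have [xn|xn] := eqVneq x n.
    subst x; move: yD zD; rewrite !inE => /orP[/eqP e|yD]; first by rewrite e adj0 in axy.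
    move=> /orP[/eqP e|zD]; first by rewrite e adj0 in axz.
    by rewrite updn !oldP //; exact: hS.
  have {}xD : x \in D by move: xD; rewrite !inE (negPf xn).
  have [yn|yn] := eqVneq y n.
    subst y; move: zD; rewrite !inE eq_sym (negPf yz) /= => zD.
    by rewrite updn !oldP //; apply: (hN x xD _).2 => //; rewrite adjC.
  have {}yD : y \in D by move: yD; rewrite !inE (negPf yn).
  have [zn|zn] := eqVneq z n.
    subst z; rewrite spreadC updn !oldP //.
    by apply: (hN x xD _).2 => //; rewrite adjC.
  have {}zD : z \in D by move: zD; rewrite !inE (negPf zn).
  by rewrite !oldP //; exact: cf2.
Qed.

End CrossingFree.

(** * Drawings with bubbles *)

Section BubbleDrawing.
Variables (R : realType) (V : finType) (E : rel V).
Hypotheses (symE : symmetric E) (irrE : irreflexive E).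
Notation W := (V + {set V})%type.
Notation pt := (R * R)%type.
Implicit Types (D : {set W}) (P : W -> pt) (o : W) (u v q w : pt).

(* [inl x] is a drawn vertex, [inr [set a; b]] the bubble of a drawn edge [ab]:
   a virtual vertex adjacent to [a] and [b] that marks where vertices may later
   be stacked on [ab]. *)
Definition adjW : rel W := fun o1 o2 =>
  match o1, o2 with
  | inl x, inl y => E x y
  | inl x, inr e | inr e, inl x => x \in e
  | inr _, inr _ => false
  end.

(** The direction is given by two points, not vertices, because its ends may be bubbles or points
    still being moved; the steps themselves use real edges only. *)
Definition step D P u v : rel V := [rel x y |
  [&& inl x \in D, inl y \in D, E x y & 0 < dp (P (inl x)) (P (inl y)) u v]].

Definition reach D P u v : rel V := connect (step D P u v).

(* [leave P o t x]: a path from [o] in the direction of [t] may start at the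
   vertex [x], which is [o] itself or an end of the edge whose bubble [o] is. *)
Definition leave P o t (x : V) : bool :=
  match o with
  | inl y => x == y
  | inr e => (x \in e) && (0 < dp (P o) (P (inl x)) (P o) t)
  end.

(** The condition at [o2] is read backwards: when [o2] is a bubble, it says that the last edge, from
    [x2] into [o2], makes an acute angle with the direction from [o1] to [o2]. *)
Definition mono D P o1 o2 : Prop :=
  exists x1 x2, [/\ leave P o1 (P o2) x1, leave P o2 (P o1) x2
    & reach D P (P o1) (P o2) x1 x2].

Definition bubble D P (e : {set V}) : Prop := exists a b,
  [/\ e = [set a; b], inl a \in D, inl b \in D, E a b
    & obtuse (P (inr e)) (P (inl a)) (P (inl b))].

Definition good D P : Prop :=
  [/\ forall e, inr e \in D -> bubble D P e,
      crossing_free adjW D P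
    & forall o1 o2, o1 \in D -> o2 \in D -> o1 != o2 -> mono D P o1 o2].

Lemma adjW_sym : symmetric adjW.
Proof. by move=> [x|e] [y|f] //=. Qed.

Lemma adjW_irr : irreflexive adjW.
Proof. by move=> [x|e] //=. Qed.

(** Reversing both an edge and the direction changes two signs, so the inner product stays the
    same. *)
Lemma mono_sym D P o1 o2 : mono D P o1 o2 -> mono D P o2 o1.
Proof.
move=> [x1 [x2 [l1 l2 r]]]; exists x2, x1; split=> //.
move: r; rewrite /reach.
have /= <- := connect_rev (step D P (P o1) (P o2)) x2 x1.
have e : [rel x y | step D P (P o1) (P o2) y x] =2 step D P (P o2) (P o1).
  move=> x y; rewrite /step /= symE andbCA; do 3 congr (_ && _).
  by congr (0 < _); rewrite /dp; ring.
by rewrite (eq_connect e).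
Qed.

Lemma reach_first D P u v x y : reach D P u v x y -> x != y ->
  exists2 z, step D P u v x z & reach D P u v z y.
Proof.
move=> /connectP[[|z s] /= p ->]; first by rewrite eqxx.
by case/andP: p => sx p _; exists z => //; apply/connectP; exists s.
Qed.

Lemma near_reach D P q v x y : reach D P q v x y ->
  \forall w \near q, reach D P w v x y.
Proof.
move=> r; have st : \forall w \near q, forall xy : V * V,
    step D P q v xy.1 xy.2 -> step D P w v xy.1 xy.2.
  apply: near_all => -[x1 y1] /= /and4P[d1 d2 e g].
  near=> w; apply/and4P; split=> //; near: w.
  by apply: near_dp_gt0 g; [exact: cvg_cst|exact: cvg_cst|exact: cvg_id|exact: cvg_cst].
apply: filterS st => w st; apply: connect_sub r => x1 y1 s; apply: connect1.
exact: (st (x1, y1) s).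
Unshelve. all: by end_near. Qed.

Lemma near_leave P o q x : leave P o q x -> \forall w \near q, leave P o w x.
Proof.
case: o => [y|e] /=; first by move=> h; near=> w.
case/andP=> h g; near=> w; rewrite h /=; near: w.
by apply: near_dp_gt0 g; [exact: cvg_cst|exact: cvg_cst|exact: cvg_cst|exact: cvg_id].
Unshelve. all: by end_near. Qed.

(** * Extending a good drawing by one vertex or bubble *)

Section Add.
Variables (D : {set W}) (P : W -> pt) (n : W) (w : pt).
Hypotheses (gD : good D P) (nD : n \notin D).
Local Notation D' := (n |: D).
Local Notation P' := (upd P n w).

Lemma port_in e x : inr e \in D -> x \in e -> inl x \in D.
Proof.
by case: gD => + _ _ => /[apply] -[a [b [-> aD bD _ _]]]; rewrite !inE => /orP[]/eqP->.
Qed.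

Lemma reach_upd u v x y : reach D P u v x y -> reach D' P' u v x y.
Proof.
apply: connect_sub => x1 y1 /and4P[xD yD e g]; apply: connect1.
by apply/and4P; split=> //; rewrite ?inE ?xD ?yD ?orbT // !(updD _ _ nD).
Qed.

Lemma leave_upd o t x : o \in D -> leave P o t x -> leave P' o t x.
Proof.
case: o => // e eD /= /andP[xe g]; rewrite xe /= !(updD _ _ nD) //.
exact: port_in eD xe.
Qed.

Lemma mono_upd o1 o2 : o1 \in D -> o2 \in D -> mono D P o1 o2 -> mono D' P' o1 o2.
Proof.
move=> d1 d2 [x1 [x2 [l1 l2 r]]]; exists x1, x2.
by rewrite !(updD _ _ nD) //; split; [exact: leave_upd|exact: leave_upd|exact: reach_upd].
Qed.

Lemma good_add : (forall e, n = inr e -> bubble D' P' e) ->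
  crossing_free adjW D' P' -> (forall o, o \in D -> mono D' P' n o) -> good D' P'.
Proof.
move=> hb cf hm; case: (gD) => bub _ mD; split=> //.
- move=> e; rewrite !inE => /orP[/eqP en|eD]; first exact: hb.
  have [a [b [ee aD bD ab o]]] := bub e eD.
  by exists a, b; rewrite !(updD _ _ nD) //; split=> //; rewrite inE ?aD ?bD orbT.
- move=> o1 o2; rewrite !inE => /orP[/eqP->|d1] /orP[/eqP->|d2]; rewrite ?eqxx // => ne.
  + exact: hm.
  + by apply: mono_sym; exact: hm.
  + by apply: mono_upd => //; exact: mD.
Qed.

End Add.

Lemma bubble_ports D P a b : bubble D P [set a; b] ->
  [/\ inl a \in D, inl b \in D & obtuse (P (inr [set a; b])) (P (inl a)) (P (inl b))].
Proof.
move=> [a' [b' [e aD bD ab ob]]].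
have : a' \in [set a; b] by rewrite e set21.
have : b' \in [set a; b] by rewrite e set22.
rewrite !inE => /orP[]/eqP eb /orP[]/eqP ea; subst a' b'; rewrite ?irrE // in ab.
by rewrite obtuseC.
Qed.

(** The new vertex has the same neighbours as the bubble [m], so its relations to edges and objects
    away from [m] are inherited from [m] by perturbation. The mutual position of [v] and [m], which
    coincide in the limit, is controlled by [obtuse_shift]. *)
Lemma add_vertex D P a b (v : V) : good D P -> inr [set a; b] \in D -> inl v \notin D ->
  (forall x, inl x \in D -> E v x = (x \in [set a; b])) ->
  exists w, good (inl v |: D) (upd P (inl v) w) /\ obtuse w (P (inl a)) (P (inl b)).
Proof.
move=> gD; set m : W := inr [set a; b] => mD vD nv; pose q := P m.
have [bub [cf1 cf2] sm] := gD.
have [aD bD ob] := bubble_ports (bub _ mD).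
have tD t : t \in [set a; b] -> inl t \in D by rewrite !inE => /orP[]/eqP->.
have C1 : \forall w \near q, forall i : V * W * W,
    [&& i.1.1 \in [set a; b], i.1.2 \in D, i.2 \in D, adjW i.1.2 i.2 &
     [&& m != i.1.2, m != i.2, inl i.1.1 != i.1.2 & inl i.1.1 != i.2]] ->
    sep w (P (inl i.1.1)) (P i.1.2) (P i.2).
  apply: (@near_all _ (V * W * W)%type) => -[[t y] z] /= /and5P[tab yD zD ayz dj].
  have h : sep q (P (inl t)) (P y) (P z) by apply: cf1 => //; exact: tD.
  exact: near_sep.
have C2 : \forall w \near q, forall i : V * W,
    [&& i.1 \in [set a; b], i.2 \in D, adjW (inl i.1) i.2 & m != i.2] ->
    spread (P (inl i.1)) w (P i.2).
  apply: (@near_all _ (V * W)%type) => -[t z] /= /and4P[tab zD atz mz].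
  by apply: near_spread; apply: cf2 => //; exact: tD.
have C3 : \forall w \near q, obtuse w (P (inl a)) (P (inl b)) by exact: near_obtuse.
have C4 : \forall w \near q, forall o, (o \in D) && (m != o) ->
    exists c x, [/\ c \in [set a; b], 0 < dp w (P (inl c)) w (P o), leave P o w x
      & reach D P w (P o) c x].
  apply: (@near_all _ W) => o /andP[oD mo].
  have [c [x [/andP[cab g] l r]]] := sm _ _ mD oD mo.
  near=> w; exists c, x; split=> //; near: w.
  - by apply: near_dp_gt0 g; [exact: cvg_id|exact: cvg_cst|exact: cvg_id|exact: cvg_cst].
  - exact: near_leave.
  - exact: near_reach.
have nU := filterI C1 (filterI C2 (filterI C3 C4)).
have [w [[/= {}C1 [{}C2 [{}C3 {}C4]]] sa sb /andP[ca cb] /andP[wa qa]]] :=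
  obtuse_shift ob (nU _ _ _).
have nbr t : adjW (inl v) t -> t \in D -> exists2 t', t = inl t' & t' \in [set a; b].
  case: t => [t|e] /= vt tD'; first by exists t; rewrite // -nv.
  by rewrite (port_in gD tD' vt) in vD.
exists w; split=> //; apply: good_add => //.
  apply: add_crossing_free => //; [exact: adjW_sym|exact: adjW_irr| |].
  - move=> u uD /nbr/(_ uD) [t ut tab]; subst u; split.
    + have S (u : W) : adjW m u -> u != inl t -> sep w (P (inl t)) q (P u).
        case: u => // u /=; move: tab; rewrite !inE => /orP[]/eqP-> /orP[]/eqP->;
        by rewrite ?eqxx.
      move=> y z yD zD ayz yt zt.
      have [ym|ym] := eqVneq y m; first by subst y; exact: S.
      have [zm|zm] := eqVneq z m.
        by subst z; apply: sepCr; apply: S => //; rewrite adjW_sym.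
      apply: (C1 (t, y, z)) => /=; rewrite tab yD zD ayz ![m == _]eq_sym ym zm.
      by rewrite ![inl t == _]eq_sym yt zt.
    + move=> z zD atz; have [->|zm] := eqVneq z m; last first.
        by apply: (C2 (t, z)); apply/and4P; split=> //; rewrite eq_sym.
      by move: tab; rewrite !inE => /orP[]/eqP->; apply/orP; left.
  - move=> u u' dt dt' /nbr/(_ dt) [t -> +] /nbr/(_ dt') [t' -> +].
    rewrite !inE => /orP[]/eqP-> /orP[]/eqP->; rewrite ?eqxx // => _.
      by case/andP: C3 => _ c3; rewrite /spread c3.
    by rewrite spreadC; case/andP: C3 => _ c3; rewrite /spread c3.
have st c t : c \in [set a; b] -> 0 < dp w (P (inl c)) w t ->
    step (inl v |: D) (upd P (inl v) w) w t v c.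
  move=> cab g; have cD := tD c cab.
  by apply/and4P; rewrite updn (updD _ _ vD) // !inE eqxx cD orbT nv.
(* The path from [v] to [m] goes through [a]. For any other object, the virtual first edge from [m]
   to its port [c] is replaced by the real edge [vc]. *)
move=> o oD; have [->|om] := eqVneq o m.
  exists v, a; rewrite updn (updD _ _ vD) //; split; first by rewrite /leave.
    by apply: (leave_upd w gD vD) => //; rewrite /leave /m set21.
  by apply: connect1; apply: st; rewrite ?set21.
have [|c [x [cab g l r]]] := C4 o; first by rewrite oD eq_sym.
exists v, x; rewrite updn (updD _ _ vD) //; split; first by rewrite /leave.
  exact: (leave_upd w gD vD).
by apply: connect_trans (connect1 (st _ _ cab g)) _; exact: reach_upd.
Unshelve. all: by end_near. Qed.

(** Meant to be applied twice, the second time with [a] and [b] exchanged. The last hypothesis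
    describes the bubbles already present at [v]: none at first, then the one of the other edge. *)
Lemma add_bubble D P a b (v : V) : good D P -> inl v \in D -> inl a \in D -> inl b \in D ->
  inr [set a; v] \notin D -> E v a -> E v b ->
  obtuse (P (inl v)) (P (inl a)) (P (inl b)) ->
  (forall x, inl x \in D -> E v x -> x = a \/ x = b) ->
  (forall e, inr e \in D -> v \in e ->
     exists2 c, 0 < c & P (inr e) = ray (P (inl v)) (P (inl a)) c) ->
  exists2 t, 0 < t &
    good (inr [set a; v] |: D) (upd P (inr [set a; v]) (ray (P (inl v)) (P (inl b)) t)).
Proof.
move=> gD vD aD bD nD va vb ob nv ext; pose q := P (inl v); set n : W := inr _ in nD *.
have [bub [cf1 cf2] sm] := gD.
have ab : inl a != inl b :> W.
  apply: contraTneq ob => -[->]; rewrite /obtuse negb_and negbK.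
  by apply/orP; right; apply/eqP; rewrite /cp; ring.
have C1 : \forall w \near q, forall i : W * W,
    [&& i.1 \in D, i.2 \in D, adjW i.1 i.2 &
     [&& inl v != i.1, inl v != i.2, inl a != i.1 & inl a != i.2]] ->
    sep w (P (inl a)) (P i.1) (P i.2).
  apply: (@near_all _ (W * W)%type) => -[y z] /= /and4P[yD zD ayz dj].
  have h : sep q (P (inl a)) (P y) (P z) by apply: cf1.
  exact: near_sep.
(* As [w] tends to [v], the edge from the bubble to [v] shrinks to a point, so it suffices to
   separate the point [v] from [yz]. If [a] or [b] is not an end of [yz], the edge from [v] to it
   gives this; otherwise [yz] is [ab] and [sep_apex] applies. *)
have C1' : \forall w \near q, forall i : W * W,
    [&& i.1 \in D, i.2 \in D, adjW i.1 i.2, inl v != i.1 & inl v != i.2] ->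
    sep w q (P i.1) (P i.2).
  apply: (@near_all _ (W * W)%type) => -[y z] /= /and5P[yD zD ayz vy vz].
  suff h : sep q q (P y) (P z) by exact: near_sep.
  have S c : inl c \in D -> E v c -> (inl c != y) && (inl c != z) -> sep q q (P y) (P z).
    move=> cD vc /andP[cy cz]; apply: (@sep_diag R q (P (inl c))).
    by apply: cf1 => //; rewrite vy vz cy cz.
  case ea : ((inl a != y) && (inl a != z)); first exact: S aD va ea.
  case eb : ((inl b != y) && (inl b != z)); first exact: S bD vb eb.
  have sab := sep_apex ob.
  move/negbT: ea; move/negbT: eb.
  rewrite !negb_and !negbK => /orP[]/eqP eb /orP[]/eqP ea; subst => //.
  - by rewrite ea eqxx in ab.
  - exact: sepCr.
  - by rewrite ea eqxx in ab.
have C2 : \forall w \near q, forall z, [&& z \in D, adjW (inl a) z & inl v != z] ->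
    spread (P (inl a)) w (P z).
  apply: (@near_all _ W) => z /and3P[zD az vz].
  by apply: near_spread; apply: cf2 => //; rewrite /= symE.
have C3 : \forall w \near q, dp w (P (inl a)) q (P (inl b)) < 0.
  have g : dp q (P (inl a)) q (P (inl b)) < 0 by case/andP: ob.
  near=> w; near: w.
  by apply: near_dp_lt0 g; [exact: cvg_id|exact: cvg_cst|exact: cvg_cst|exact: cvg_cst].
(* A path leaving [v] through [a] can leave the new bubble through [a] instead. Any other path is
   prefixed by the link from the bubble to [v], which has the direction of [b - v]. *)
have C4 : \forall w \near q, forall o, (o \in D) && (inl v != o) ->
    (exists x, [/\ 0 < dp w (P (inl a)) w (P o), leave P o w x & reach D P w (P o) a x]) \/
    (exists x, [/\ 0 < dp q (P (inl b)) w (P o), leave P o w x & reach D P w (P o) v x]).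
  apply: (@near_all _ W) => o /andP[oD vo].
  have [c [x [/eqP cv l r]]] := sm _ _ vD oD vo; subst c.
  have near_b : 0 < dp q (P (inl b)) q (P o) ->
      \forall w \near q, 0 < dp q (P (inl b)) w (P o).
    move=> g; near=> w; near: w.
    by apply: near_dp_gt0 g; [exact: cvg_cst|exact: cvg_cst|exact: cvg_id|exact: cvg_cst].
  have [vx|vx] := eqVneq v x.
    (* Here [o] is a bubble at [v], on the ray from [a]; the obtuse angle at [v] makes the angle
       between [b - v] and the direction to [o] acute. *)
    subst x; near=> w; right; exists v; split; near: w.
    - apply: near_b; case: o oD vo l {r} => [y|e] eD ne /=.
        by move=> /eqP ey; rewrite ey eqxx in ne.
      move=> /andP[ve _]; have [k k0 ->] := ext e eD ve.
      have -> : dp q (P (inl b)) q (ray (P (inl v)) (P (inl a)) k) =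
          - (k * dp q (P (inl a)) q (P (inl b))) by rewrite /q /dp /=; ring.
      by case/andP: ob => o1 _; rewrite oppr_gt0 pmulr_rlt0.
    - exact: near_leave.
    - by near=> w; exact: connect0.
  have [z /and4P[_ zD vz g] r'] := reach_first r vx.
  case: (nv z zD vz) => ez; subst z; near=> w; [left|right]; exists x; split; near: w;
    try exact: near_leave; try exact: near_reach.
  - by apply: near_dp_gt0 g; [exact: cvg_id|exact: cvg_cst|exact: cvg_id|exact: cvg_cst].
  - exact: near_b.
have nU := filterI C1 (filterI C1' (filterI C2 (filterI C3 C4))).
have [t t0 [/= {}C1 [{}C1' [{}C2 [{}C3 {}C4]]]]] := near_ray (P (inl b)) (nU _ _ _ _).
exists t => //; set w := ray _ _ _ in C1 C1' C2 C3 C4 *.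
have obw : obtuse w (P (inl a)) q by exact: obtuse_ray.
have leaven t' c : c \in [set a; v] -> inl c \in D -> 0 < dp w (P (inl c)) w t' ->
    leave (upd P n w) n t' c.
  move=> cs cD g; rewrite -[leave _ _ _ _]/((c \in [set a; v]) &&
    (0 < dp (upd P n w n) (upd P n w (inl c)) (upd P n w n) t')).
  by rewrite cs updn (updD _ _ nD).
have vza z : z \in D -> adjW (inl v) z -> z = inl a \/ z = inl b \/
    (exists2 c, 0 < c & P z = ray q (P (inl a)) c).
  case: z => [z|e] zD /=; first by case/(nv z zD) => ->; [left|right; left].
  by move=> ve; right; right; exact: ext.
apply: good_add => //.
- move=> _ [<-]; exists a, v; rewrite updn !(updD _ _ nD) //; split=> //.
  + by rewrite inE aD orbT.
  + by rewrite inE vD orbT.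
  + by rewrite symE.
- apply: add_crossing_free => //; [exact: adjW_sym|exact: adjW_irr| |].
  + move=> [s|e] sD //=; rewrite !inE => /orP[]/eqP->; split.
    * have S (u : W) : u \in D -> adjW (inl v) u -> u != inl a -> sep w (P (inl a)) q (P u).
        move=> uD avu; case: (vza u uD avu) => [->|hu _]; first by rewrite eqxx.
        apply: sep_ray => //; case: hu => [->|hu]; [by left|by right].
      move=> y z yD zD ayz ya za.
      have [yv|yv] := eqVneq y (inl v); first by subst y; exact: S.
      have [zv|zv] := eqVneq z (inl v).
        by subst z; apply: sepCr; apply: S => //; rewrite adjW_sym.
      by apply: (C1 (y, z)) => /=; rewrite yD zD ayz ![inl _ == _]eq_sym yv zv ya za.
    * move=> z zD az; have [->|zv] := eqVneq z (inl v).
        by apply/orP; left; exact: cp_ray.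
      by apply: C2; rewrite zD az eq_sym.
    * move=> y z yD zD ayz yv zv.
      by apply: (C1' (y, z)) => /=; rewrite yD zD ayz ![inl _ == _]eq_sym yv zv.
    * move=> z zD avz; apply: (spread_ray t0 ob).
      by case: (vza z zD avz) => [->|[->|]]; [left|right; left|right; right].
  + move=> [s|e] [s'|e'] //= sD sD'; case/andP: obw => _ cw.
    rewrite !inE => /orP[]/eqP-> /orP[]/eqP->; rewrite ?eqxx // => _.
      by rewrite /spread cw.
    by rewrite spreadC /spread cw.
- move=> o oD; have [->|ov] := eqVneq o (inl v).
    exists v, v; rewrite updn (updD _ _ nD) //; split.
    + apply: leaven; rewrite ?set22 // dp_ray.
      have -> : dp q (P (inl b)) w q = t * dp q (P (inl b)) q (P (inl b)).
        by rewrite /w /q /dp /=; ring.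
      by rewrite !mulr_gt0 // (obtuse_gt0 ob).
    + by rewrite /leave.
    + exact: connect0.
  have [|[x [g l r]]|[x [g l r]]] := C4 o; first by rewrite oD eq_sym.
    exists a, x; rewrite updn (updD _ _ nD) //; split.
    + by apply: leaven; rewrite ?set21.
    + exact: (leave_upd w gD nD).
    + exact: reach_upd.
  exists v, x; rewrite updn (updD _ _ nD) //; split.
  + by apply: leaven; rewrite ?set22 // dp_ray mulr_gt0.
  + exact: (leave_upd w gD nD).
  + exact: reach_upd.
Unshelve. all: by end_near. Qed.

(** * Induction along the construction of a 2-tree *)

Definition drawn (S : {set V}) : {set W} := [set o |
  match o with
  | inl x => x \in S
  | inr e => [exists a in S, exists b in S, E a b && (e == [set a; b])]
  end].

Lemma drawnP (S : {set V}) e : reflect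
  (exists a b, [/\ a \in S, b \in S, E a b & e = [set a; b]]) (inr e \in drawn S).
Proof.
rewrite inE; apply: (iffP exists_inP).
  by move=> [a aS /exists_inP[b bS /andP[ab /eqP->]]]; exists a, b.
move=> [a [b [aS bS ab ->]]]; exists a => //; apply/exists_inP.
by exists b; rewrite ?ab ?eqxx.
Qed.

(** A single edge with its bubble serves as the base, so that [K_3] arises by one stacking step. *)
Lemma good_edge (x y : V) : E x y -> exists P, good (drawn [set x; y]) P.
Proof.
move=> xy; pose m : W := inr [set x; y].
(* The vectors from [(0, 1)] to the two ends have inner product [-3] and determinant [-4]. The
   default [(0, 1)] matters only for [m], the one other object drawn. *)
pose P (o : W) : pt :=
  if o == inl x then (2, 0) else if o == inl y then (- 2, 0) else (0, 1).
have nxy : x != y by apply: contraTneq xy => ->; rewrite irrE.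
have Px : P (inl x) = (2, 0) by rewrite /P eqxx.
have Py : P (inl y) = (- 2, 0).
  by rewrite /P eqxx; case: eqP => // -[e]; rewrite e eqxx in nxy.
have Pm : P m = (0, 1) by [].
have DP o : o \in drawn [set x; y] -> o = inl x \/ o = inl y \/ o = m.
  case: o => [z|e].
    by rewrite !inE => /orP[]/eqP->; [left|right; left].
  move=> /drawnP[a [b [+ + + ->]]]; rewrite !inE => /orP[]/eqP-> /orP[]/eqP->;
    rewrite ?irrE // => _; right; right => //.
  by rewrite finset.setUC.
have xD : inl x \in drawn [set x; y] by rewrite !inE eqxx.
have yD : inl y \in drawn [set x; y] by rewrite !inE eqxx orbT.
exists P; split.
- move=> e /DP[//|[//|[->]]]; exists x, y; split=> //.
  rewrite Px Py -/m Pm /obtuse /dp /cp /=.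
  by apply/andP; split; [lra|apply/eqP; lra].
- split=> [o1 o2 o3 o4|o1 o2 o3] /DP h1 /DP h2 /DP h3.
    (* Two disjoint edges would need four distinct objects, and only three are drawn. *)
    move=> /DP h4 a12 a34 dj; exfalso; move: a12 a34 dj.
    case: h1 => [->|[->|->]]; case: h2 => [->|[->|->]]; case: h3 => [->|[->|->]];
      case: h4 => [->|[->|->]]; by rewrite ?adjW_irr ?eqxx ?andbF.
  case: h1 => [->|[->|->]]; case: h2 => [->|[->|->]]; case: h3 => [->|[->|->]];
    rewrite ?adjW_irr ?eqxx // => _ _ _; rewrite ?Px ?Py ?Pm;
    by apply/orP; left; rewrite /cp /=; apply/eqP; lra.
- have Mxy : mono (drawn [set x; y]) P (inl x) (inl y).
    exists x, y; split; rewrite /leave ?eqxx //; apply: connect1.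
    by apply/and4P; split => //; rewrite Px Py /dp /=; lra.
  have Mm z : z \in [set x; y] -> mono (drawn [set x; y]) P (inl z) m.
    move=> zxy; exists z, z; split; rewrite /leave ?eqxx //; last exact: connect0.
    rewrite /m zxy -/m Pm; move: zxy.
    by rewrite !inE => /orP[]/eqP->; rewrite ?Px ?Py /dp /=; lra.
  move=> o1 o2 /DP[->|[->|->]] /DP[->|[->|->]]; rewrite ?eqxx // => _ //;
    try (by apply: Mm; rewrite ?set21 ?set22); try (apply: mono_sym => //);
    by apply: Mm; rewrite ?set21 ?set22.
Qed.

(** Three additions in turn: [v] near the bubble of [ab], the bubble of [av], the bubble of [bv]. *)
Lemma good_step (S : {set V}) P a b (v : V) : good (drawn S) P -> a \in S -> b \in S -> E a b ->
  v \notin S -> {in S, forall x, E v x = (x \in [set a; b])} ->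
  exists P', good (drawn (v |: S)) P'.
Proof.
move=> g0 aS bS ab vS nv.
have sS e : inr e \in drawn S -> v \notin e.
  move=> /drawnP[c [d [cS dS _ ->]]]; rewrite !inE negb_or.
  by rewrite !(contraNneq _ vS) // => ->.
have abD : inr [set a; b] \in drawn S by apply/drawnP; exists a, b.
have vD : inl v \notin drawn S by rewrite inE.
have [|w [g1 ob]] := add_vertex g0 abD vD; first by move=> x; rewrite inE; exact: nv.
set D1 := _ |: _ in g1; set P1 := upd _ _ _ in g1.
have va : E v a by rewrite nv ?set21.
have vb : E v b by rewrite nv ?set22.
have vD1 : inl v \in D1 by rewrite !inE eqxx.
have aD1 : inl a \in D1 by rewrite !inE aS orbT.
have bD1 : inl b \in D1 by rewrite !inE bS orbT.
have nD1 (e : {set V}) : v \in e -> inr e \notin D1.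
  by move=> ve; rewrite in_setU1 /=; apply: contraL ve; exact: sS.
have ob1 : obtuse (P1 (inl v)) (P1 (inl a)) (P1 (inl b)).
  by rewrite /P1 updn !(updD _ _ vD) // inE.
have nv1 x : inl x \in D1 -> E v x -> x = a \/ x = b.
  rewrite !inE => /orP[/eqP[->]|xS]; first by rewrite irrE.
  by rewrite nv // !inE => /orP[]/eqP->; [left|right].
have nav := nD1 _ (set22 a v).
have [e eD ve|t t0 g2] := add_bubble g1 vD1 aD1 bD1 nav va vb ob1 nv1.
  by rewrite (negPf (nD1 e ve)) in eD.
set D2 := _ |: _ in g2; set P2 := upd _ _ _ in g2.
have oldD o : o \in D1 -> o \in D2 by move=> oD; rewrite in_setU1 oD orbT.
have oldP o : o \in D1 -> P2 o = P1 o by exact: updD.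
have nbv : inr [set b; v] \notin D2.
  rewrite in_setU1 negb_or nD1 ?set22 // andbT.
  apply/negP => /eqP[e]; have : b \in [set a; v] by rewrite -e set21.
  rewrite !inE => /orP[]/eqP eb; first by rewrite eb irrE in ab.
  by rewrite -eb bS in vS.
have ob2 : obtuse (P2 (inl v)) (P2 (inl b)) (P2 (inl a)) by rewrite obtuseC !oldP.
have nv2 x : inl x \in D2 -> E v x -> x = b \/ x = a.
  by rewrite in_setU1 /= => xD vx; case: (nv1 x xD vx) => ->; [right|left].
have ext e : inr e \in D2 -> v \in e ->
    exists2 c, 0 < c & P2 (inr e) = ray (P2 (inl v)) (P2 (inl b)) c.
  rewrite in_setU1 => /orP[/eqP->|eD] ve; last by rewrite (negPf (nD1 e ve)) in eD.
  by exists t; rewrite // (oldP _ vD1) (oldP _ bD1) /P2 updn.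
have [t' _ g3] := add_bubble g2 (oldD _ vD1) (oldD _ bD1) (oldD _ aD1) nbv vb va ob2 nv2 ext.
exists (upd P2 (inr [set b; v]) (ray (P2 (inl v)) (P2 (inl a)) t')).
(* The edges gained with [v] are exactly [va] and [vb], whose bubbles have now been placed. *)
suff -> : drawn (v |: S) = inr [set b; v] |: D2 by [].
apply/setP => -[x|e]; first by rewrite !inE.
rewrite !in_setU1 /=; apply/drawnP/idP.
- move=> [c [d [/finset.setU1P[cv|cS] /finset.setU1P[dv|dS] cd ->]]].
  + by rewrite cv dv irrE in cd.
  + move: cd; rewrite cv nv // !inE [[set v; d]]finset.setUC => /orP[]/eqP->;
    by rewrite eqxx ?orbT.
  + move: cd; rewrite dv symE nv // !inE => /orP[]/eqP->; by rewrite eqxx ?orbT.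
  + have -> : inr [set c; d] \in drawn S by apply/drawnP; exists c, d.
    by rewrite !orbT.
- move=> /or3P[/eqP[->]|/eqP[->]|/drawnP[c [d [cS dS cd ->]]]].
  + by exists b, v; rewrite !inE bS eqxx orbT symE.
  + by exists a, v; rewrite !inE aS eqxx orbT symE.
  + by exists c, d; rewrite !inE cS dS !orbT.
Qed.

Lemma good_two_tree (S : {set V}) : two_tree_on E S -> exists P, good (drawn S) P.
Proof.
elim=> [{}S S3 ES|{}S a b v _ [P gP] aS bS ab vS nv]; last exact: good_step gP aS bS ab vS nv.
have [x xS] : exists x, x \in S by apply/card_gt0P; rewrite S3.
have /cards2P[y [z [yz Sx]]] : #|S :\ x| == 2 by rewrite -eqSS -S3 (cardsD1 x S) xS.
have xyz : x \notin [set y; z] by rewrite -Sx !inE eqxx.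
have SE : S = x |: [set y; z] by rewrite -Sx finset.setD1K.
have yS : y \in S by rewrite SE !inE eqxx orbT.
have zS : z \in S by rewrite SE !inE eqxx !orbT.
have Eyz : E y z by rewrite ES.
have [P gP] := good_edge Eyz.
rewrite SE; apply: (good_step gP _ _ Eyz xyz); rewrite ?set21 ?set22 // => t tyz.
rewrite tyz ES // ?SE ?inE -?in_set2 ?tyz ?orbT //.
by apply: contraNneq xyz => ->.
Qed.

End BubbleDrawing.

(** * Drawings as row vectors *)

Section Transfer.
Variables (R : realType) (V : finType) (E : rel V).
Hypothesis symE : symmetric E.
Notation W := (V + {set V})%type.
Notation pt := (R * R)%type.

Definition vec (a : pt) : 'rV[R]_2 := \row_i (if i == 0 then a.1 else a.2).

Definition comb (a b : pt) (t : R) : pt :=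
  ((1 - t) * a.1 + t * b.1, (1 - t) * a.2 + t * b.2).

Lemma vec_inj : injective vec.
Proof.
move=> [a1 a2] [b1 b2] /rowP e.
by have := e 0; have := e 1; rewrite !mxE /= => -> ->.
Qed.

Lemma dot_vec a b c d : dot (vec b - vec a) (vec d - vec c) = dp a b c d.
Proof. by rewrite /dot !big_ord_recl big_ord0 !mxE /= addr0. Qed.

Lemma segment_vec a b z : segment (vec a) (vec b) z ->
  exists t, 0 <= t <= 1 /\ z = vec (comb a b t).
Proof.
case=> t; rewrite /= in_itv /= => t01 <-; exists t; split=> //.
by apply/rowP => i; rewrite !mxE /comb; case: (i == 0).
Qed.

Lemma segmentC (x y z : 'rV[R]_2) : segment x y z -> segment y x z.
Proof.
case=> t; rewrite /= in_itv /= => /andP[t0 t1] <-; exists (1 - t).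
  by rewrite /= in_itv /=; apply/andP; split; lra.
by rewrite subKr addrC.
Qed.

Lemma sep_disjoint a b c d z : sep a b c d ->
  segment (vec a) (vec b) z -> segment (vec c) (vec d) z -> False.
Proof.
move=> [f [k [ha hb hc hd]]] /segment_vec[t [/andP[t0 t1] ->]].
move=> /segment_vec[s [/andP[s0 s1] /vec_inj e]].
have L x y r : lin f (comb x y r) = (1 - r) * lin f x + r * lin f y.
  by rewrite /lin /=; ring.
have C (x y r l : R) : 0 <= r -> r <= 1 -> x < l -> y < l -> (1 - r) * x + r * y < l.
  move=> r0 r1 xl yl; pose m := Num.max x y.
  have ml : m < l by rewrite gt_max xl yl.
  have [xm ym] : x <= m /\ y <= m by rewrite !le_max !lexx orbT.
  have h1 : 0 <= (1 - r) * (m - x) by rewrite mulr_ge0 // subr_ge0.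
  have h2 : 0 <= r * (m - y) by rewrite mulr_ge0 // subr_ge0.
  lra.
have ht : lin f (comb a b t) < k by rewrite L C.
have hs : - lin f (comb c d s) < - k.
  by rewrite L opprD -!mulrN C // ltrN2.
by rewrite -e in hs; lra.
Qed.

(** A common point other than [a] would give [t (b - a) = s (c - a)] with [t > 0] and [s >= 0]; then
    the determinant vanishes and the inner product is nonnegative. *)
Lemma spread_meet a b c z : spread a b c ->
  segment (vec a) (vec b) z -> segment (vec a) (vec c) z -> z = vec a.
Proof.
move=> sp /segment_vec[t [/andP[t0 t1] ->]] /segment_vec[s [/andP[s0 s1] /vec_inj]].
case: a b c sp => [a1 a2] [b1 b2] [c1 c2]; rewrite /spread /cp /dp /comb /= => sp [e1 e2].
congr vec; have [->|t_neq0] := eqVneq t 0; first by congr pair; ring.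
have f1 : t * (b1 - a1) = s * (c1 - a1) by lra.
have f2 : t * (b2 - a2) = s * (c2 - a2) by lra.
exfalso; case/orP: sp => [/negP[]|].
  rewrite -(mulrI_eq0 _ (mulfI t_neq0)) mulrBr !mulrA f1 f2; apply/eqP; ring.
have t_gt0 : 0 < t by rewrite lt_neqAle eq_sym t_neq0.
rewrite -(pmulr_rlt0 _ t_gt0) mulrDr !mulrA f1 f2 -!mulrA -mulrDr -!expr2.
by rewrite ltNge mulr_ge0 // addr_ge0 // sqr_ge0.
Qed.

(** Cauchy-Schwarz; in the plane [|x|^2 |y|^2 - <x, y>^2] is the square of the determinant. *)
Lemma dot_le_enorm (x y : 'rV[R]_2) : dot x y <= enorm x * enorm y.
Proof.
rewrite /enorm; have dxx (u : 'rV[R]_2) : 0 <= dot u u.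
  by apply: sumr_ge0 => i _; rewrite -expr2 sqr_ge0.
rewrite -sqrtrM //; apply: le_trans (ler_norm _) _; rewrite -sqrtr_sqr ler_wsqrtr //.
rewrite /dot !big_ord_recl !big_ord0 !addr0 -subr_ge0.
set a := x _ _; set b := x _ _; set c := y _ _; set d := y _ _.
rewrite [leRHS](_ : _ = (a * d - b * c) ^+ 2) ?sqr_ge0 //; ring.
Qed.

Lemma angle_lt_pihalf (x y : 'rV[R]_2) : 0 < dot x y -> angle x y < pi / 2.
Proof.
move=> xy; have n_gt0 : 0 < enorm x * enorm y := lt_le_trans xy (dot_le_enorm x y).
rewrite /angle; set c := _ / _.
have c_gt0 : 0 < c by rewrite divr_gt0.
have c_le1 : c <= 1 by rewrite ler_pdivrMr // mul1r dot_le_enorm.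
have cI : - 1 <= c <= 1 by apply/andP; split => //; lra.
have pi_ge0 : 0 <= pi :> R := pi_ge0 R.
rewrite -ltr_cos ?in_itv /= ?acos_ge0 ?acos_lepi //; last by apply/andP; split; lra.
by rewrite cos_pihalf acosK // in_itv.
Qed.

(** The inner product with [v - u] strictly increases along the path. *)
Lemma step_uniq D (P : W -> pt) u v x s : path (step E D P u v) x s -> uniq (x :: s).
Proof.
move=> p; pose h (y : V) := dp (P (inl x)) (P (inl y)) u v.
apply: (@map_uniq _ _ h); apply: lt_sorted_uniq; rewrite /= path_map.
apply: sub_path p => y z /and4P[_ _ _ g] /=.
move: g; rewrite /h /dp; lra.
Qed.

Lemma good_drawing P : good E (drawn E [set: V]) P ->
  let p x := vec (P (inl x)) in
  [/\ straight_line_drawing p, planar_drawing E p & strongly_monotone_drawing E p].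
Proof.
move=> [_ [cf1 cf2] sm] p.
have inD x : inl x \in drawn E [set: V] by rewrite !inE.
have rch u v : u != v -> reach E (drawn E [set: V]) P (P (inl u)) (P (inl v)) u v.
  by move=> uv; have [x [y [/eqP-> /eqP->]]] := sm _ _ (inD u) (inD v) uv.
(* If two distinct vertices coincided, the direction between them would be zero, and no first step
   of a path joining them could have positive inner product with it. *)
have injp : injective p.
  move=> u v /vec_inj e; apply/eqP/contraT => uv.
  have [z /and4P[_ _ _]] := reach_first (rch u v uv) uv.
  by rewrite e /dp !subrr !mulr0 addr0 ltxx.
have planar a b c d z : E a b -> E c d -> [set a; b]%SET != [set c; d]%SET ->
    segment (p a) (p b) z -> segment (p c) (p d) z ->
    exists w, [/\ w \in [set a; b]%SET, w \in [set c; d]%SET & z = p w].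
  have share x y y' : E x y -> E x y' -> y != y' -> segment (p x) (p y) z ->
      segment (p x) (p y') z -> z = p x.
    move=> xy xy' yy'; apply: spread_meet.
    by apply: cf2 => //; rewrite ?inD.
  move=> ab cd ne sab scd.
  have [ac|ac] := eqVneq a c.
    subst c; exists a; rewrite !set21; split=> //; apply: (share a b d) => //.
    by apply: contraNneq ne => ->.
  have [ad|ad] := eqVneq a d.
    subst d; exists a; rewrite set21 set22; split=> //.
    apply: (share a b c ab _ _ sab (segmentC scd)); first by rewrite symE.
    by apply: contraNneq ne => ->; rewrite finset.setUC.
  have [bc|bc] := eqVneq b c.
    subst c; exists b; rewrite set21 set22; split=> //.
    apply: (share b a d _ cd _ (segmentC sab) scd); first by rewrite symE.
    by apply: contraNneq ne => ->; rewrite finset.setUC.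
  have [bd|bd] := eqVneq b d.
    subst d; exists b; rewrite !set22; split=> //.
    apply: (share b a c _ _ _ (segmentC sab) (segmentC scd)); rewrite 1?symE //.
  exfalso; apply: sep_disjoint sab scd; apply: cf1; rewrite ?inD //.
  by apply/and4P.
split=> //.
- split=> // a b w ab wab sw.
  have wa : w != a by apply: contraNneq wab => ->; rewrite set21.
  (* The path from [w] to [a] supplies an edge [wx]. If [w] lay on [ab], the edges [ab] and [wx]
     would meet in [p w], which forces [w] to be an end of [ab]. *)
  have [x /and4P[_ _ wx _] _] := reach_first (rch w a wa) wa.
  have ne : [set a; b]%SET != [set w; x]%SET.
    by apply: contraNneq wab => ->; rewrite set21.
  have sww : segment (p w) (p x) (p w).
    by exists 0; rewrite /= ?in_itv /= ?lexx ?ler01 // subr0 scale1r scale0r addr0.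
  have [y [yab _ /injp wy]] := planar a b w x (p w) ab wx ne sw sww.
  by rewrite wy yab in wab.
- move=> u v uv; have /connectP[s ps vs] := rch u v uv; exists s; split=> //.
  + rewrite /graph_path (step_uniq ps) andbT.
    by apply: sub_path ps => x y /and4P[].
  + rewrite /strongly_monotone_path -vs; apply: sub_path ps => x y /and4P[_ _ _ g].
    by apply: angle_lt_pihalf; rewrite dot_vec.
Qed.

End Transfer.

Theorem theorem4 (R : realType) (V : finType) (E : rel V) :
  two_tree E ->
  exists p : V -> 'rV[R]_2,
    [/\ straight_line_drawing p, planar_drawing E p
      & strongly_monotone_drawing E p].
Proof.
move=> [[symE irrE] tt]; have [P gP] := good_two_tree R symE irrE tt.
by exists (fun x => vec (P (inl x))); exact: good_drawing gP.
Qed.
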